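(* In the setting described in the context, for any $\beta\in(0,1]$, the performance $C^{(\mathbf k)}_\beta$ of the threshold-based strategy $f^{(\mathbf k)}_\beta$ (used with the Kalman-filter like estimator $g^*$) is given by $$C^{(\mathbf k)}_\beta=\frac{L^{(\mathbf k)}_\beta}{M^{(\mathbf k)}_\beta}.$$
   Context: $\mathbb X$ is $\mathbb Z$ or $\mathbb R$; the source is $X_{t+1}=aX_t+W_t$ with $a\in\mathbb X$ and $\{W_t\}$ i.i.d. on $\mathbb X$ with symmetric and unimodal distribution (pdf if $\mathbb X=\mathbb R$, pmf if $\mathbb X=\mathbb Z$). $\mathbb S$ is a finite ordered set of channel states (larger = better) and $\{S_t\}$ a Markov chain on it with transition matrix $Q$, independent of the source. $\mathbb U=\{0,u^{(1)},\dots,u^{(m)}\}\subset\mathbb R_{\ge0}$, $u^{(0)}=0$, $u^{(i)}<u^{(i+1)}$. The packet-drop probability $p(s,u)$ is weakly decreasing in $u$ and decreasing in $s$, with $p(s,0)=1$. The transmission cost $\lambda$ is weakly increasing with $\lambda(0)=0$ and finite at the maximum power; the distortion $d$ is even and quasi-convex with $d(0)=0$. The estimator $g^*$ is: $\hat X_0=0$ and, for $t>0$, $\hat X_t=a\hat X_{t-1}$ if no packet is received and $\hat X_t$ equals the received symbol otherwise. Thresholds $\mathbf k=\{k^{(i)}(s)\}$ satisfy $0=k^{(0)}(s)\le k^{(1)}(s)\le\dots\le k^{(m)}(s)\le k^{(m+1)}(s)=\infty$; the strategy $f^{(\mathbf k)}_\beta$ uses $U_t=u^{(i)}$ when $|E_t|\in[k^{(i)}(S_{t-1}),k^{(i+1)}(S_{t-1}))$.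 Post-decision model: fix a reference channel state $s^\circ\in\mathbb S$ and start from $(E^+_{-1},S_{-1})=(0,s^\circ)$. For $t\ge0$: the pre-decision error is $E_t=aE^+_{t-1}+W_{t-1}$; $U_t$ is chosen by $f^{(\mathbf k)}_\beta$ from $(E_t,S_{t-1})$; $S_t=s'$ with probability $Q_{S_{t-1}s'}$; the post-decision error is $E^+_t=E_t$ with probability $p(S_t,U_t)$ (packet dropped) and $E^+_t=0$ with probability $1-p(S_t,U_t)$ (packet received). The per-step cost is $\lambda(U_t)+d(E^+_t)$. The performance $C^{(\mathbf k)}_\beta$ is $(1-\beta)\mathbb E[\sum_{t=0}^\infty\beta^t(\lambda(U_t)+d(E^+_t))]$ for $\beta\in(0,1)$ and $\lim_{T\to\infty}\frac1T\mathbb E[\sum_{t=0}^{T-1}(\lambda(U_t)+d(E^+_t))]$ for $\beta=1$, with this initial condition. Under $f^{(\mathbf k)}_\beta$ the process $\{(E^+_t,S_t)\}$ is Markov. Let $\tau^{(0)}=0$ and, for $n\ge1$, $\tau^{(n)}=\min\{t>\tau^{(n-1)}:(E^+_{t-1},S_{t-1})=(0,s^\circ)\}$ be the stopping times at which it revisits $(0,s^\circ)$. Define $$L^{(\mathbf k)}_\beta=\mathbb E\Big[\sum_{t=0}^{\tau^{(1)}-1}\beta^t(\lambda(U_t)+d(E^+_t))\Bigm|E^+_{-1}=0,S_{-1}=s^\circ\Big],\qquad M^{(\mathbf k)}_\beta=\mathbb E\Big[\sum_{t=0}^{\tau^{(1)}-1}\beta^t\Bigm|E^+_{-1}=0,S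_{-1}=s^\circ\Big].$$
   Formalization: For β=1 the formal theorem assumes that L and M are not both infinite, since then the quotient L/M is the undefined form ∞/∞ (e.g. when the process never returns to (0,s°)); all other cases are covered, including existence of the average-cost limit. *)

(* Defs.v *)
From HB Require Import structures.
From mathcomp Require Import all_boot all_order all_algebra.
From mathcomp Require Import all_classical all_reals all_analysis.
From mathcomp Require Import ring.
Set Implicit Arguments.
Unset Strict Implicit.
Unset Printing Implicit Defensive.
Import Order.TTheory GRing.Theory Num.Theory.
Import numFieldNormedType.Exports.
Local Open Scope classical_set_scope.
Local Open Scope ring_scope.

(* Both alphabets are treated as sets of reals; functions on the alphabet are
   functions on R of which only the values on [symbols] are constrained. *)
Inductive alphabet := Integers | Reals.

Definition symbols (R : realType) (A : alphabet) : set R :=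
  match A with
  | Integers => range (fun n : int => n%:~R)
  | Reals => setT
  end.

Definition even_on (R : realType) (X : set R) (f : R -> R) :=
  forall x, X x -> f (- x) = f x.

Definition unimodal_on (R : realType) (X : set R) (f : R -> R) :=
  exists c, X c /\
    (forall x y, X x -> X y -> x <= y -> y <= c -> f x <= f y) /\
    (forall x y, X x -> X y -> c <= x -> x <= y -> f y <= f x).

Definition quasi_convex_on (R : realType) (X : set R) (f : R -> R) :=
  forall x y z, X x -> X y -> X z -> x <= y -> y <= z ->
    f y <= Num.max (f x) (f z).

(* The random variable Z takes its values in the alphabet and its law has
   probability mass function (Integers) or probability density function
   (Reals) f. *)
Definition has_density (R : realType) (A : alphabet) (f : R -> R)
    d (T : measurableType d) (P : probability T R) (Z : T -> R) : Prop :=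
  (forall w, symbols A (Z w)) /\
  match A with
  | Integers => forall x, symbols A x -> P (Z @^-1` [set x]) = (f x)%:E
  | Reals => [/\ measurable_fun setT f, forall x, 0 <= f x &
      forall B, measurable B ->
        P (Z @^-1` B) = (\int[@lebesgue_measure R]_(x in B) (f x)%:E)%E]
  end.

(* Channel states are ordered by quality, a larger state being a better one.
   The power levels are u 0, ..., u m; values of u beyond m are irrelevant. *)
Record system (R : realType) (disp : Order.disp_t) (SS : finOrderType disp) :=
  System {
  alph : alphabet;
  gain : R;
  density : R -> R;
  transition : SS -> SS -> R;
  nlevels : nat;
  power : nat -> R;
  drop_prob : SS -> R -> R;
  transmission_cost : R -> R;
  distortion : R -> R;

  gain_symbol : symbols alph gain;
  density_even : even_on (symbols alph) density;
  density_unimodal : unimodal_on (symbols alph) density;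

  transition_ge0 : forall s s', 0 <= transition s s';
  transition_sum1 : forall s, \sum_(s' : SS) transition s s' = 1;

  power0 : power 0 = 0;
  power_lt : forall i, (i < nlevels)%N -> power i < power i.+1;

  drop_prob_ge0 : forall s i, (i <= nlevels)%N -> 0 <= drop_prob s (power i);
  drop_prob_le1 : forall s i, (i <= nlevels)%N -> drop_prob s (power i) <= 1;
  drop_prob_decr_power : forall s i j, (i <= j)%N -> (j <= nlevels)%N ->
    drop_prob s (power j) <= drop_prob s (power i);
  drop_prob_decr_state : forall s s' i, (i <= nlevels)%N -> (s <= s')%O ->
    drop_prob s' (power i) <= drop_prob s (power i);
  drop_prob0 : forall s, drop_prob s 0 = 1;

  transmission_cost0 : transmission_cost 0 = 0;
  transmission_cost_incr : forall i j, (i <= j)%N -> (j <= nlevels)%N ->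
    transmission_cost (power i) <= transmission_cost (power j);

  distortion_even : even_on (symbols alph) distortion;
  distortion_quasi_convex : quasi_convex_on (symbols alph) distortion;
  distortion0 : distortion 0 = 0
}.

Section errors.
Context (R : realType) (T : Type).
Variables (a : R) (W : nat -> T -> R) (drop : nat -> T -> bool).

(* Time conventions for the post-decision model, which starts at time -1:
     W n = W_{n-1},   S n = S_{n-1},   post_error n = E^+_{n-1},
     drop n = "packet dropped at time n",   pre_error n = E_n. *)
Fixpoint post_error (n : nat) (w : T) : R :=
  if n is t.+1 then
    if drop t w then a * post_error t w + W t w else 0
  else 0.

Definition pre_error (n : nat) (w : T) : R := a * post_error n w + W n w.

(* source n = X_{n-1}, and estimate n is the value at time n-1 of the
   Kalman-filter like estimator; both start from x0 at time -1. *)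
Fixpoint source (x0 : R) (n : nat) (w : T) : R :=
  if n is t.+1 then a * source x0 t w + W t w else x0.

Fixpoint estimate (x0 : R) (n : nat) (w : T) : R :=
  if n is t.+1 then
    if drop t w then a * estimate x0 t w else source x0 t.+1 w
  else x0.

Lemma post_error_estimate x0 n w :
  post_error n w = source x0 n w - estimate x0 n w.
Proof.
by elim: n => [|n IHn] /=; rewrite ?IHn; [ring | case: (drop n w); ring].
Qed.

Lemma pre_error_estimate x0 n w :
  pre_error n w = source x0 n.+1 w - a * estimate x0 n w.
Proof. by rewrite /pre_error (post_error_estimate x0) /=; ring. Qed.

End errors.

Section model.
Context (R : realType) (disp : Order.disp_t) (SS : finOrderType disp).
Variable Sy : system R SS.

Let m := nlevels Sy.

(* Only k s 0, ..., k s m.+1 matter; the thresholds k s 1, ..., k s m may be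
   infinite. *)
Definition thresholds (k : SS -> nat -> \bar R) : Prop :=
  forall s, [/\ k s 0 = 0%E, k s m.+1 = +oo%E &
    forall i, (i <= m)%N -> (k s i <= k s i.+1)%E].

Definition threshold_strategy (k : SS -> nat -> \bar R) (e : R) (s : SS) : R :=
  power Sy (odflt ord0
    [pick i : 'I_m.+1 | (k s i <= `|e|%:E)%E && (`|e|%:E < k s i.+1)%E]).

Lemma threshold_strategyE (k : SS -> nat -> \bar R) e s i :
  thresholds k -> (i <= m)%N -> (k s i <= `|e|%:E < k s i.+1)%E ->
  threshold_strategy k e s = power Sy i.
Proof.
move=> /(_ s)[_ _ kS] im /andP[ki ki1]; rewrite /threshold_strategy.
have kmono p q : (p <= q)%N -> (q <= m.+1)%N -> (k s p <= k s q)%E.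
  elim: q => [|q IHq]; first by rewrite leqn0 => /eqP ->.
  rewrite leq_eqVlt => /orP[/eqP -> //|pq] qm.
  by apply: (le_trans (IHq pq (ltnW qm))); exact: kS.
case: pickP => [j /andP[kj kj1]|/(_ (Ordinal (im : (i < m.+1)%N)))]; last first.
  by rewrite /= ki ki1.
congr (power Sy _) => /=; apply/eqP; rewrite eqn_leq; apply/andP; split.
- rewrite leqNgt; apply/negP => ij.
  have := lt_le_trans ki1 (le_trans (kmono _ _ ij (ltnW (ltn_ord j))) kj).
  by rewrite ltxx.
- rewrite leqNgt; apply/negP => ji.
  have := lt_le_trans kj1 (le_trans (kmono _ _ ji (leq_trans im (leqnSn _))) ki).
  by rewrite ltxx.
Qed.

Section process.
Context d (T : measurableType d) (P : probability T R).
Variables (k : SS -> nat -> \bar R) (s0 : SS).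
Variables (W : nat -> {RV P >-> R}) (S : nat -> T -> SS).
Variable drop : nat -> {mfun T >-> bool}.

Definition error_before (n : nat) (w : T) : R := pre_error (gain Sy) W drop n w.

Definition error_after (n : nat) (w : T) : R := post_error (gain Sy) W drop n w.

Definition control (n : nat) (w : T) : R :=
  threshold_strategy k (error_before n w) (S n w).

Definition noise_events (n : nat) : set (set T) :=
  [set W n @^-1` B | B in measurable].

Definition state_events (n : nat) : set (set T) :=
  [set S n @^-1` [set s] | s in [set: SS]].

Definition drop_events (n : nat) : set (set T) :=
  [set [set w | drop n w]].

Definition past_events (n : nat) : set (set T) :=
  \bigcup_(t in `I_n) (noise_events t `|` state_events t.+1 `|` drop_events t).

(* The noise is independent of the past (so that it is i.i.d.), S evolves by
   the transition matrix whatever the source and the past packet drops, and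
   given everything up to (E_n, S_n, U_n) the packet sent at time n is dropped
   with probability p(S_n, U_n). *)
Definition post_decision_process : Prop :=
  [/\ (forall n, has_density (alph Sy) (density Sy) P (W n)),
      (forall w, S 0%N w = s0),
      (forall n s, measurable (S n @^-1` [set s])) &
  [/\ (forall n A B, <<s past_events n >> A -> noise_events n B ->
         P (A `&` B) = (P A * P B)%E),
      (forall n A s, <<s past_events n `|` noise_events n >> A ->
         P (A `&` S n.+1 @^-1` [set s]) =
           (\int[P]_(w in A) (transition Sy (S n w) s)%:E)%E) &
      (forall n A,
         <<s past_events n `|` noise_events n `|` state_events n.+1 >> A ->
         P (A `&` [set w | drop n w]) =
           (\int[P]_(w in A) (drop_prob Sy (S n.+1 w) (control n w))%:E)%E)]].

Definition step_cost (n : nat) (w : T) : R :=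
  transmission_cost Sy (control n w) + distortion Sy (error_after n.+1 w).

Definition average_cost (n : nat) : \bar R :=
  ((n%:R^-1)%:E * \int[P]_w (\sum_(0 <= t < n) step_cost t w)%:E)%E.

Definition performance (beta : R) : \bar R :=
  if beta < 1 then
    ((1 - beta)%:E *
       \int[P]_w (\sum_(0 <= t <oo) (beta ^+ t * step_cost t w)%:E))%E
  else limn average_cost.

(* revisit_time n is the stopping time tau^(n), equal to +oo when there are
   fewer than n revisits. *)
Fixpoint revisit_time (n : nat) (w : T) : \bar R :=
  if n is j.+1 then
    ereal_inf [set (t%:R : R)%:E | t in
      [set t | (revisit_time j w < (t%:R : R)%:E)%E /\
               error_after t w = 0 /\ S t w = s0]]
  else 0%E.

Definition cycle_cost (beta : R) : \bar R :=
  (\int[P]_w (\sum_(0 <= t <oo | (t%:R : R)%:E < revisit_time 1 w)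
                (beta ^+ t * step_cost t w)%:E))%E.

Definition cycle_length (beta : R) : \bar R :=
  (\int[P]_w (\sum_(0 <= t <oo | (t%:R : R)%:E < revisit_time 1 w)
                (beta ^+ t)%:E))%E.

End process.
End model.

(* Main.v *)
(* Decompose the cost at time t according to the last visit s <= t of the
   post-decision process to (0, s0).  Such a visit regenerates the process, so
   with u_s the probability of a visit at s, r_j the expected cost at time j on
   the event that there is no visit in {1, ..., j}, and g_j the probability of
   that event,
     E[cost_t] = sum_(s <= t) u_s r_(t-s),   1 = sum_(s <= t) u_s g_(t-s).
   Moreover L = sum_j beta^j r_j and M = sum_j beta^j g_j.  For beta < 1 both
   convolutions factor: E[sum_t beta^t cost_t] = U L and 1 / (1 - beta) = U M
   with U = sum_s beta^s u_s.  For beta = 1, put A_n = sum_(s < n) u_s; then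
   A_n sum_(j < K) r_j <= sum_(t < n + K) E[cost_t] <= A_(n + K) L, and the same
   bounds with g instead of r give A_n / n -> 1 / M. *)
Require Import Defs.
From HB Require Import structures.
From mathcomp Require Import all_boot all_order all_algebra.
From mathcomp Require Import all_classical all_reals all_analysis.
From mathcomp Require Import measurable_realfun.
Import Order.TTheory GRing.Theory Num.Theory.
Import numFieldNormedType.Exports.
Local Open Scope classical_set_scope.
Local Open Scope ring_scope.
Set Implicit Arguments.
Unset Strict Implicit.
Unset Printing Implicit Defensive.

(** * Laws that are proportional *)

Section measure_lemmas.
Context d (T : measurableType d) (R : realType).
Local Open Scope ereal_scope.

(** [mrestr m mZ] agrees with [m] inside [Z] and vanishes outside. Integrals over an event thus
    become integrals over the whole space, where image measures apply. *)
Lemma ge0_integral_mrestr (m : {measure set T -> \bar R}) (Z : set T)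
    (mZ : measurable Z) (f : T -> \bar R) :
  measurable_fun setT f -> (forall x, 0 <= f x) ->
  \int[mrestr m mZ]_x f x = \int[m]_(x in Z) f x.
Proof.
move=> mf f0.
have := @ge0_integral_setU _ T R (mrestr m mZ) _ _ mZ (measurableC mZ) f.
rewrite setUv => -> //; last exact/disj_setPCl.
rewrite (@eq_measure_integral _ _ _ _ m (mrestr m mZ)); last first.
  by move=> A mA AZ; rewrite /= /mrestr setIidl.
rewrite (@eq_measure_integral _ _ _ (~` Z) mzero (mrestr m mZ)).
  by rewrite integral_measure_zero adde0.
move=> A mA AZ; rewrite /= /mrestr /mzero.
rewrite (_ : A `&` Z = set0) ?measure0//.
by rewrite -subset0 => x [/AZ].
Qed.

(** Both sides integrate [f] against the image laws of [X] and [X'] restricted to [Z] and [Z'], and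
    the hypothesis makes the first law [c] times the second. *)
Lemma integral_scaled_law d' (Y : measurableType d')
    (m m' : {measure set T -> \bar R}) (X X' : T -> Y) (Z Z' : set T)
    (c : R) (f : Y -> \bar R) :
  measurable_fun setT X -> measurable_fun setT X' ->
  measurable Z -> measurable Z' -> (0 <= c)%R ->
  (forall B, measurable B ->
    m (Z `&` X @^-1` B) = c%:E * m' (Z' `&` X' @^-1` B)) ->
  measurable_fun setT f -> (forall x, 0 <= f x) ->
  \int[m]_(x in Z) f (X x) = c%:E * \int[m']_(x in Z') f (X' x).
Proof.
move=> mX mX' mZ mZ' c0 H mf f0.
rewrite -(ge0_integral_mrestr m mZ) ?[in RHS]/=; last 2 first.
- exact: measurableT_comp.
- by move=> x; exact: f0.
rewrite -(ge0_integral_mrestr m' mZ'); last 2 first.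
- exact: measurableT_comp.
- by move=> x; exact: f0.
have E (n : {measure set T -> \bar R}) (V : T -> Y)
    (mV : measurable_fun setT V) :
  \int[n]_x f (V x) = \int[pushforward n V]_x f x.
  by rewrite ge0_integral_pushforward ?preimage_setT.
rewrite (E _ X mX) (E _ X' mX').
rewrite -(ge0_integral_mscale _ _ (NngNum c0)) //.
apply: eq_measure_integral => A mA _.
by rewrite /= /mscale /= /pushforward /mrestr ![_ @^-1` A `&` _]setIC H.
Qed.

Lemma integral_partition (I : finType) (m : {measure set T -> \bar R})
    (key : T -> I) (D : set T) (f : T -> \bar R) :
  (forall i, measurable (key @^-1` [set i])) -> measurable D ->
  measurable_fun D f -> (forall x, 0 <= f x) ->
  \int[m]_(x in D) f x =
  \sum_(i : I) \int[m]_(x in D `&` key @^-1` [set i]) f x.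
Proof.
move=> mk mD mf f0.
have DE : D = \big[setU/set0]_(i <- index_enum I) (D `&` key @^-1` [set i]).
  rewrite -bigcup_seq; apply/seteqP; split => [x Dx|x [i _ []//]].
  by exists (key x) => //=; rewrite mem_index_enum.
rewrite {1}DE ge0_integral_bigsetU//.
- by move=> i; exact: measurableI.
- exact: index_enum_uniq.
- apply/trivIsetP => i j _ _ ij; rewrite -subset0 => x [[_ /= xi] [_ xj]].
  by move: ij; rewrite -xi -xj eqxx.
- by rewrite -DE.
Qed.

Lemma measure_partition (I : finType) (m : {measure set T -> \bar R})
    (key : T -> I) (D : set T) :
  (forall i, measurable (key @^-1` [set i])) -> measurable D ->
  m D = \sum_(i : I) m (D `&` key @^-1` [set i]).
Proof.
move=> mk mD; have := @integral_partition I m key D (cst 1) mk mD.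
rewrite integral_cst// mul1e => ->//.
by apply: eq_bigr => i _; rewrite integral_cst ?mul1e//; exact: measurableI.
Qed.

(** By independence both joint measures factor on measurable rectangles, where they differ by the
    factor [c]. Rectangles form a pi-system generating the product, so the finite measures are
    proportional everywhere. *)
Lemma scaled_joint_law d1 d2 (Y1 : measurableType d1) (Y2 : measurableType d2)
    (P : probability T R) (X X' : T -> Y1) (W W' : T -> Y2) (A A' : set T)
    (c : R) :
  measurable_fun setT X -> measurable_fun setT X' ->
  measurable_fun setT W -> measurable_fun setT W' ->
  measurable A -> measurable A' -> (0 <= c)%R ->
  (forall B, measurable B ->
    P (A `&` X @^-1` B) = c%:E * P (A' `&` X' @^-1` B)) ->
  (forall B, measurable B -> P (W @^-1` B) = P (W' @^-1` B)) ->
  (forall B C, measurable B -> measurable C ->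
    P (A `&` X @^-1` B `&` W @^-1` C) = P (A `&` X @^-1` B) * P (W @^-1` C)) ->
  (forall B C, measurable B -> measurable C ->
    P (A' `&` X' @^-1` B `&` W' @^-1` C) =
      P (A' `&` X' @^-1` B) * P (W' @^-1` C)) ->
  forall D, measurable D ->
    P (A `&` (fun w => (X w, W w)) @^-1` D) =
    c%:E * P (A' `&` (fun w => (X' w, W' w)) @^-1` D).
Proof.
move=> mX mX' mW mW' mA mA' c0 HX HW HI HI' D mD.
have mXW : measurable_fun setT (fun w => (X w, W w)).
  exact: measurable_fun_pair.
have mXW' : measurable_fun setT (fun w => (X' w, W' w)).
  exact: measurable_fun_pair.
pose V w := (X w, W w); pose V' w := (X' w, W' w).
pose G := [set B `*` C | B in @measurable _ Y1 & C in @measurable _ Y2].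
pose m1 : {measure set (Y1 * Y2)%type -> \bar R} :=
  pushforward (mrestr P mA) V.
pose m2 : {measure set (Y1 * Y2)%type -> \bar R} :=
  mscale (NngNum c0) (pushforward (mrestr P mA') V').
suff: m1 mXW D = m2 mXW' D by rewrite ![A `&` _]setIC ![A' `&` _]setIC.
apply: (measure_unique G (fun=> setT)) => //.
- exact: measurable_prod_measurableType.
- move=> _ _ [B mB [C mC <-]] [B' mB' [C' mC' <-]].
  exists (B `&` B'); first exact: measurableI.
  by exists (C `&` C'); [exact: measurableI | rewrite setXI].
- by move=> _; exists setT => //; exists setT => //; rewrite setXTT.
- by apply/seteqP; split => // x _; exists 0%N.
- move=> _ [B mB [C mC <-]]; change (P (V @^-1` (B `*` C) `&` A) =
    c%:E * P (V' @^-1` (B `*` C) `&` A')).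
  have E (X0 : T -> Y1) (W0 : T -> Y2) A0 :
    (fun w => (X0 w, W0 w)) @^-1` (B `*` C) `&` A0 =
    A0 `&` X0 @^-1` B `&` W0 @^-1` C.
    by apply/seteqP; split => x /=; tauto.
  by rewrite (E X W A) (E X' W' A') HI// HI'// HX// HW// muleA.
- move=> _; rewrite /m1 /= /pushforward /mrestr preimage_setT setTI.
  exact: (le_lt_trans (probability_le1 P mA) (ltry _)).
Qed.

End measure_lemmas.

(** * Alphabet, distortion and thresholds *)

Section alphabet_lemmas.
Context (R : realType).
Variable A : alphabet.

Lemma symbols0 : symbols A (0 : R).
Proof. by case: A => //=; exists 0; rewrite ?mulr0z. Qed.

Lemma symbolsN (x : R) : symbols A x -> symbols A (- x).
Proof. by case: A => //= -[z _ <-]; exists (- z); rewrite ?mulrNz. Qed.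

Lemma symbolsD (x y : R) : symbols A x -> symbols A y -> symbols A (x + y).
Proof.
by case: A => //= -[z _ <-] [z' _ <-]; exists (z + z'); rewrite // mulrzDr.
Qed.

Lemma symbolsM (x y : R) : symbols A x -> symbols A y -> symbols A (x * y).
Proof.
by case: A => //= -[z _ <-] [z' _ <-]; exists (z * z'); rewrite // intrM.
Qed.

Lemma symbols_norm (x : R) : symbols A x -> symbols A `|x|.
Proof.
by move=> Ax; have [_|_] := ger0P x => //; exact: symbolsN.
Qed.

(** For [Reals] both laws are the same integral. For [Integers] only point masses are given, so [B]
    is cut into countably many pieces with at most one integer each, and the law becomes a series
    determined by [f]. *)
Lemma has_density_eq_law d (T : measurableType d) (P : probability T R)
    (f : R -> R) (Z Z' : T -> R) :
  measurable_fun setT Z -> measurable_fun setT Z' ->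
  has_density A f P Z -> has_density A f P Z' ->
  forall B, measurable B -> P (Z @^-1` B) = P (Z' @^-1` B).
Proof.
move=> mZ mZ' [ZA fZ] [ZA' fZ'] B mB.
case: A ZA fZ ZA' fZ' => [ZA fZ ZA' fZ'|_ [_ _ ->//] _ [_ _ ->//]].
pose F (k : nat) : set R :=
  B `&` [set x | exists2 z : int, x = z%:~R & pickle z = k].
(* The guard accepts only codes [k] of integers, so the default [0] of [odflt] never contributes. *)
have law (V : T -> R) : measurable_fun setT V ->
    (forall w, symbols Integers (V w)) ->
    (forall x, symbols Integers x -> P (V @^-1` [set x]) = (f x)%:E) ->
  P (V @^-1` B) = (\sum_(k <oo)
      if `[< exists2 z : int, B z%:~R & pickle z = k >]
      then (f (odflt 0 (unpickle k : option int))%:~R)%:E else 0)%E.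
  move=> mV VA fV.
  have FE k : V @^-1` F k = if `[< exists2 z : int, B z%:~R & pickle z = k >]
      then V @^-1` [set (odflt 0 (unpickle k : option int))%:~R] else set0.
    case: asboolP => [[z Bz <-]|nz].
      rewrite pickleK /=; apply/seteqP; split => w /=.
        by move=> [_ [z' -> /(pcan_inj pickleK) ->]].
      by move=> ->; split => //; exists z.
    rewrite -subset0 => w [BVw [z Vz zk]].
    by apply: nz; exists z => //; rewrite -Vz.
  have VB : V @^-1` B = \bigcup_k V @^-1` F k.
    apply/seteqP; split => [w Bw|w [k _ []//]].
    have [z _ zV] := VA w.
    by exists (pickle z) => //; split => //; exists z.
  have mF k : measurable (V @^-1` F k).
    rewrite FE; case: ifP => // _.
    by rewrite -[X in measurable X]setTI; exact: mV.
  rewrite VB measure_bigcup//.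
    rewrite eseries_mkcond; apply: eq_eseriesr => i _; rewrite in_setT FE.
    case: ifPn => _; last exact: measure0.
    by apply: fV; exists (odflt 0 (unpickle i)).
  apply/trivIsetP => i j _ _ ij.
  rewrite -subset0 => w [[_ [z Vz zi]] [_ [z' Vz' zj]]].
  move: ij; rewrite -zi -zj; have : z%:~R = z'%:~R :> R by rewrite -Vz -Vz'.
  by move/intr_inj => ->; rewrite eqxx.
by rewrite (law Z)// (law Z').
Qed.

End alphabet_lemmas.

(** * Monotone distortion, and measurability of the threshold strategy *)

Section system_lemmas.
Context (R : realType) (disp : Order.disp_t) (SS : finOrderType disp).
Variable Sy : system R SS.

(** Quasi-convexity is applied at [- y <= x <= y], where evenness equates the two end values. *)
Lemma distortion_mono x y : symbols (alph Sy) x -> symbols (alph Sy) y ->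
  0 <= x -> x <= y -> distortion Sy x <= distortion Sy y.
Proof.
move=> Ax Ay x0 xy.
have := distortion_quasi_convex (symbolsN Ay) Ax Ay _ xy.
rewrite distortion_even// maxxx; apply.
by rewrite (le_trans _ x0)// oppr_le0 (le_trans x0).
Qed.

Lemma distortion_ge0 x : symbols (alph Sy) x -> 0 <= distortion Sy x.
Proof.
move=> Ax; rewrite -(@distortion0 _ _ _ Sy).
have [x0|x0] := leP 0 x; first exact: distortion_mono (symbols0 _ _) _ _ _.
rewrite -(distortion_even Ax); apply: distortion_mono => //.
- exact: symbols0.
- exact: symbolsN.
- by rewrite oppr_ge0 ltW.
Qed.

(* The distortion is only constrained on the alphabet, hence need not be
   measurable on the reals; rounding the argument gives a measurable function
   with the same values on the alphabet. *)
Definition rounded_distortion (x : R) : R :=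
  distortion Sy (if alph Sy is Integers then (Num.floor `|x|)%:~R else `|x|).

Lemma rounded_distortionE x : symbols (alph Sy) x ->
  rounded_distortion x = distortion Sy x.
Proof.
move=> Ax; rewrite /rounded_distortion.
transitivity (distortion Sy `|x|).
  congr distortion; move: (symbols_norm Ax).
  by case: (alph Sy) => //= -[z _ <-]; rewrite intrKfloor.
by have [//|_] := ger0P x; rewrite distortion_even.
Qed.

Lemma rounded_distortion_ge0 x : 0 <= rounded_distortion x.
Proof.
rewrite /rounded_distortion; apply: distortion_ge0.
by case: (alph Sy) => //=; exists (Num.floor `|x|).
Qed.

Lemma measurable_rounded_distortion : measurable_fun setT rounded_distortion.
Proof.
pose r (y : R) := if alph Sy is Integers then (Num.floor y)%:~R else y.
(* Cutting off at [0] makes [h] nondecreasing on the whole line and changes nothing at a norm. *)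
pose h y := distortion Sy (r (Num.max y 0)).
have -> : rounded_distortion = h \o Num.norm.
  by apply/funext => x /=; rewrite /h max_l.
apply: measurableT_comp; last exact: normr_measurable.
apply: nondecreasing_measurable => // x y xy; apply: distortion_mono.
- by rewrite /r; case: (alph Sy) => //=; exists (Num.floor (Num.max x 0)).
- by rewrite /r; case: (alph Sy) => //=; exists (Num.floor (Num.max y 0)).
- rewrite /r; case: (alph Sy); last by rewrite le_max lexx orbT.
  by rewrite ler0z floor_ge0 le_max lexx orbT.
- have : Num.max x 0 <= Num.max y 0.
    by rewrite ge_max !le_max xy lexx orbT.
  by rewrite /r; case: (alph Sy) => // ?; rewrite ler_int; exact: le_floor.
Qed.

Variables (k : SS -> nat -> \bar R) (hk : thresholds Sy k).

Let level s i := [set x : R | (k s i <= `|x|%:E)%E && (`|x|%:E < k s i.+1)%E].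

Lemma measurable_level s i : measurable (level s i).
Proof.
have mn : measurable_fun setT (fun x : R => `|x|%:E).
  by apply/measurable_EFinP; exact: normr_measurable.
rewrite (_ : level s i = (setT `&` [set x : R | (k s i <= `|x|%:E)%E]) `&`
                         (setT `&` [set x : R | (`|x|%:E < k s i.+1)%E])).
  apply: measurableI.
  - exact: emeasurable_fun_c_infty.
  - exact: emeasurable_fun_infty_o.
by rewrite !setTI; apply/seteqP; split => x;
  [move/andP|move=> [? ?]; apply/andP].
Qed.

(** Descent from the infinite last threshold: each step finds the level or lowers the upper
    threshold, and the zero first threshold stops it. *)
Lemma level_cover s x : exists2 i, (i <= nlevels Sy)%N & level s i x.
Proof.
have [k0 km kS] := hk s.
have x0 : (k s 0 <= `|x|%:E)%E by rewrite k0 lee_fin.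
suff H n : (n <= nlevels Sy)%N -> (`|x|%:E < k s n.+1)%E ->
    exists2 i, (i <= nlevels Sy)%N & level s i x.
  by apply: (H (nlevels Sy)); rewrite // km ltry.
elim: n => [|n IHn] nm xn.
  by exists 0%N => //; apply/andP.
have [xn'|xn'] := ltP `|x|%:E (k s n.+1); first exact: IHn (ltnW nm) _.
by exists n.+1 => //; apply/andP.
Qed.

Lemma threshold_strategy_level s x :
  exists2 i, (i <= nlevels Sy)%N & threshold_strategy Sy k x s = power Sy i.
Proof.
have [i im ix] := level_cover s x; exists i => //.
exact: threshold_strategyE.
Qed.

(** The strategy takes finitely many values on measurable levels, so [f] may be arbitrary. This
    serves for the transmission cost and the drop probability, for which no measurability is
    assumed. *)
Lemma measurable_threshold_strategy (f : R -> R) s :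
  measurable_fun setT (fun x => f (threshold_strategy Sy k x s)).
Proof.
move=> _ B mB; rewrite setTI.
rewrite (_ : _ @^-1` B =
  \bigcup_(i in [set i | (i <= nlevels Sy)%N /\ B (f (power Sy i))]) level s i).
  by apply: bigcup_measurable => i _; exact: measurable_level.
apply/seteqP; split => x /=.
  move=> Bx; have [i im ix] := level_cover s x.
  by exists i => //; split => //; rewrite -(threshold_strategyE hk im ix).
by move=> [i [im Bi] ix]; rewrite (threshold_strategyE hk im ix).
Qed.

Lemma transmission_cost_strategy_ge0 s x :
  0 <= transmission_cost Sy (threshold_strategy Sy k x s).
Proof.
have [i im ->] := threshold_strategy_level s x.
rewrite -(@transmission_cost0 _ _ _ Sy) -(@power0 _ _ _ Sy).
exact: transmission_cost_incr.
Qed.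

Lemma drop_prob_strategy_ge0 s s' x :
  0 <= drop_prob Sy s' (threshold_strategy Sy k x s).
Proof.
by have [i im ->] := threshold_strategy_level s x; exact: drop_prob_ge0.
Qed.

End system_lemmas.

(** * Regeneration at the visits to the reference state *)

Section process_lemmas.
Context (R : realType) (disp : Order.disp_t) (SS : finOrderType disp).
Variable Sy : system R SS.
Variables (k : SS -> nat -> \bar R) (hk : thresholds Sy k).
Context d (T : measurableType d) (P : probability T R).
Variables (s0 : SS) (W : nat -> {RV P >-> R}) (S : nat -> T -> SS).
Variable drop : nat -> {mfun T >-> bool}.
Hypothesis hproc : post_decision_process Sy k s0 W S drop.

(** [F], [G] and [H] are the information before the noise of step [n], after it, and after the next
    channel state, matching the three clauses of [post_decision_process]. *)
Let F n := <<s past_events W S drop n >>.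
Let e := error_after Sy W drop.
Let E := error_before Sy W drop.
Let G n := <<s past_events W S drop n `|` noise_events W n >>.
Let H n := <<s past_events W S drop n `|` noise_events W n `|`
               state_events S n.+1 >>.

Let mS n s : measurable (S n @^-1` [set s]).
Proof. by case: hproc. Qed.

Let S0 w : S 0%N w = s0.
Proof. by case: hproc. Qed.

Let mdrop n : measurable [set w | drop n w].
Proof.
rewrite (_ : [set w | drop n w] = drop n @^-1` [set true]); last first.
  by apply/seteqP; split.
by rewrite -[X in measurable X]setTI; exact: measurable_funPT.
Qed.

(** * Filtrations and adaptedness of the errors *)

Lemma past_events_le m n : (m <= n)%N ->
  past_events W S drop m `<=` past_events W S drop n.
Proof.
by move=> mn A [t /= tm At]; exists t => //=; exact: leq_trans mn.
Qed.

Lemma sigma_past_le m n : (m <= n)%N -> F m `<=` F n.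
Proof. by move=> mn; apply: sub_sigma_algebra2; exact: past_events_le. Qed.

Lemma sigma_past_noise n : F n `<=` G n.
Proof. by apply: sub_sigma_algebra2; exact: subsetUl. Qed.

Lemma sigma_noise_state n : G n `<=` H n.
Proof. by apply: sub_sigma_algebra2; exact: subsetUl. Qed.

Lemma sigma_noise_next n : G n `<=` F n.+1.
Proof.
apply: sub_sigma_algebra2 => A [|nA]; first exact: past_events_le.
by exists n => //=; left; left.
Qed.

Lemma sigma_state_measurable n : H n `<=` measurable.
Proof.
apply: smallest_sub; first exact: sigma_algebra_measurable.
move=> A [[[t _ [[|]|]]|]|].
- move=> [B mB <-]; rewrite -[X in measurable X]setTI.
  exact: measurable_funPT.
- by move=> [s _ <-].
- by move=> ->.
- move=> [B mB <-]; rewrite -[X in measurable X]setTI.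
  exact: measurable_funPT.
- by move=> [s _ <-].
Qed.

Lemma sigma_noise_measurable n : G n `<=` measurable.
Proof.
exact: subset_trans (@sigma_noise_state n) (@sigma_state_measurable n).
Qed.

Lemma sigma_past_measurable n : F n `<=` measurable.
Proof.
exact: subset_trans (@sigma_past_noise n) (@sigma_noise_measurable n).
Qed.

Lemma sigma_past_state n s : F n (S n @^-1` [set s]).
Proof.
case: n => [|n]; last first.
  apply: sub_sigma_algebra; exists n => //=.
  by left; right; exists s.
(* [past_events] never records [S 0], but this state is constant, so its events are trivial. *)
have [->|ns] := eqVneq s s0.
  rewrite (_ : _ @^-1` _ = setT); last first.
    by apply/seteqP; split => // w _ /=; exact: S0.
  exact: (@measurableT _ (g_sigma_algebraType (past_events W S drop 0))).
rewrite (_ : _ @^-1` _ = set0); last first.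
  by rewrite -subset0 => w /=; rewrite S0 => /esym/eqP; apply/negP.
exact: (@measurable0 _ (g_sigma_algebraType (past_events W S drop 0))).
Qed.

(** Adaptedness of [e n] is assumed so that the result can serve inside the induction of
    [sigma_error_after]. Giving [T] the smaller sigma-algebra reduces it to measurability of a
    sum. *)
Lemma error_before_after n : (forall B, measurable B -> F n (e n @^-1` B)) ->
  forall B, measurable B -> G n (E n @^-1` B).
Proof.
move=> me B mB.
pose U : measurableType _ :=
  g_sigma_algebraType (past_events W S drop n `|` noise_events W n).
have me' : measurable_fun [set: U] (e n : U -> R).
  by move=> _ C mC; rewrite setTI; apply: sigma_past_noise; exact: me.
have mW' : measurable_fun [set: U] (W n : U -> R).
  move=> _ C mC; rewrite setTI; apply: sub_sigma_algebra.
  by right; exists C.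
have : measurable_fun [set: U] (E n : U -> R).
  apply: measurable_funD => //.
  exact: (measurableT_comp (mulrl_measurable (gain Sy)) me').
by move=> /(_ measurableT B mB); rewrite setTI.
Qed.

Lemma error_after_next n w :
  e n.+1 w = if drop n w then E n w else 0.
Proof. by []. Qed.

Lemma sigma_error_after n B : measurable B -> F n (e n @^-1` B).
Proof.
elim: n B => [|n IHn] B mB.
  pose U : measurableType _ := g_sigma_algebraType (past_events W S drop 0).
  have : measurable_fun [set: U] (cst 0 : U -> R) by exact: measurable_cst.
  by move=> /(_ measurableT B mB); rewrite setTI.
pose U : measurableType _ := g_sigma_algebraType (past_events W S drop n.+1).
have mE : measurable_fun [set: U] (E n : U -> R).
  move=> _ C mC; rewrite setTI; apply: sigma_noise_next.
  exact: error_before_after.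
have md : measurable_fun [set: U] (drop n : U -> bool).
  apply: (@measurable_fun_bool _ U _ _ true).
  rewrite setTI; apply: sub_sigma_algebra; exists n => //=; right.
  by apply/seteqP; split.
have : measurable_fun [set: U] (e n.+1 : U -> R).
  by apply: measurable_fun_ifT => //; exact: measurable_cst.
by move=> /(_ measurableT B mB); rewrite setTI.
Qed.

Lemma sigma_error_before n B : measurable B -> G n (E n @^-1` B).
Proof. by apply: error_before_after; exact: sigma_error_after. Qed.

Lemma measurable_error_before n : measurable_fun setT (E n).
Proof.
move=> _ B mB; rewrite setTI; apply: sigma_noise_measurable.
exact: sigma_error_before.
Qed.

Lemma measurable_error_after n : measurable_fun setT (e n).
Proof.
move=> _ B mB; rewrite setTI; apply: sigma_past_measurable.
exact: sigma_error_after.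
Qed.

Lemma symbols_error_after n w : symbols (alph Sy) (e n w).
Proof.
elim: n w => [|n IHn] w; first exact: symbols0.
rewrite error_after_next; case: (drop n w); last exact: symbols0.
apply: symbolsD; first by apply: symbolsM; [exact: gain_symbol|exact: IHn].
by have [/(_ n)[]] := hproc.
Qed.

(** The finite-valued part of one step. Once it is fixed, the cost and the next state depend on
    [E n] alone, so events and integrals are split along it. *)
Let key n w := (S n w, S n.+1 w, drop n w : bool).

Let mkey n q : measurable (key n @^-1` [set q]).
Proof.
case: q => [[s s'] b].
rewrite (_ : _ @^-1` _ = S n @^-1` [set s] `&` S n.+1 @^-1` [set s'] `&`
                         drop n @^-1` [set b]); last first.
  by apply/seteqP; split => w; rewrite /key /=;
    [case=> -> -> -> | case=> [[-> ->] ->]].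
apply: measurableI; first exact: measurableI.
by rewrite -[X in measurable X]setTI; exact: measurable_funPT.
Qed.

Let cost_of (q : SS * SS * bool) (x : R) : R :=
  transmission_cost Sy (threshold_strategy Sy k x q.1.1) +
  rounded_distortion Sy (if q.2 then x else 0).

Let cost_of_ge0 q x : 0 <= cost_of q x.
Proof.
apply: addr_ge0; first exact: transmission_cost_strategy_ge0.
exact: rounded_distortion_ge0.
Qed.

Let measurable_cost_of q : measurable_fun setT (cost_of q).
Proof.
apply: measurable_funD; first exact: measurable_threshold_strategy.
case: q.2; first exact: measurable_rounded_distortion.
exact: measurable_cst.
Qed.

Let c := step_cost Sy k W S drop.

Lemma step_costE n w : c n w = cost_of (key n w) (E n w).
Proof.
rewrite /cost_of /= -error_after_next rounded_distortionE//.
exact: symbols_error_after.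
Qed.

Lemma step_cost_ge0 n w : 0 <= c n w.
Proof. by rewrite step_costE. Qed.

Lemma measurable_step_cost n : measurable_fun setT (c n).
Proof.
move=> _ B mB; rewrite setTI.
rewrite (_ : _ @^-1` B = \bigcup_(q in [set: SS * SS * bool])
  (key n @^-1` [set q] `&` (cost_of q \o E n) @^-1` B)); last first.
  apply/seteqP; split => [w /= Bw|w [q _ [/= kq]]].
    by exists (key n w) => //; split => //=; rewrite -step_costE.
  by rewrite -kq -step_costE.
apply: fin_bigcup_measurable => // q _; apply: measurableI => //.
rewrite -[X in measurable X]setTI.
exact: (measurableT_comp (measurable_cost_of q) (measurable_error_before n)).
Qed.

(* The cost and the next state are governed by the same kernel whatever the
   time, so a proportionality between the laws of the state at times n and n',
   restricted to past events A and A', propagates through one transition; the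
   kernel itself never has to be written down. *)
Section step.
Local Open Scope ereal_scope.
Variables (n n' : nat) (A A' : set T) (u : R).
Hypotheses (FA : F n A) (FA' : F n' A') (u0 : (0 <= u)%R).
Hypothesis Hstate : forall s B, measurable B ->
  P (A `&` S n @^-1` [set s] `&` e n @^-1` B) =
  u%:E * P (A' `&` S n' @^-1` [set s] `&` e n' @^-1` B).

(** [E n] is a fixed function of [e n] and [W n], and the noise is independent of [F n] with the
    same law at [n] and [n'], so proportionality passes to the joint laws. *)
Lemma scaled_error_before s B : measurable B ->
  P (A `&` S n @^-1` [set s] `&` E n @^-1` B) =
  u%:E * P (A' `&` S n' @^-1` [set s] `&` E n' @^-1` B).
Proof.
move=> mB.
have FI m C : F m C -> F m (C `&` S m @^-1` [set s]).
  move=> FC; apply: (@measurableI _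
    (g_sigma_algebraType (past_events W S drop m))) => //.
  exact: sigma_past_state.
have [hd _ _ [hW _ _]] := hproc.
pose f (p : R * R) := (gain Sy * p.1 + p.2)%R.
have mf : measurable_fun setT f.
  apply: measurable_funD => //; apply: measurable_funM => //.
have indep m C B1 B2 : F m C -> measurable B1 -> measurable B2 ->
  P (C `&` e m @^-1` B1 `&` W m @^-1` B2) =
  P (C `&` e m @^-1` B1) * P (W m @^-1` B2).
  move=> FC mB1 mB2; apply: (hW m); last by exists B2.
  apply: (@measurableI _
    (g_sigma_algebraType (past_events W S drop m))) => //.
  exact: sigma_error_after.
apply: (@scaled_joint_law _ T R _ _ R R P (e n) (e n') (W n) (W n')
  (A `&` S n @^-1` [set s]) (A' `&` S n' @^-1` [set s]) u _ _ _ _ _ _ _ _ _ _ _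
  (f @^-1` B)) => //.
- exact: measurable_error_after.
- exact: measurable_error_after.
- by apply: (@sigma_past_measurable n); exact: FI.
- by apply: (@sigma_past_measurable n'); exact: FI.
- exact: Hstate.
- by move=> C mC; apply: (has_density_eq_law _ _ (hd n) (hd n')).
- by move=> B1 B2; apply: indep; exact: FI.
- by move=> B1 B2; apply: indep; exact: FI.
- by rewrite -[X in measurable X]setTI; exact: mf.
Qed.

Let sub_event m s s' B C := C `&` S m @^-1` [set s] `&` S m.+1 @^-1` [set s']
  `&` E m @^-1` B.

Let sub_eventH m C s s' B : F m C -> measurable B -> H m (sub_event m s s' B C).
Proof.
move=> FC mB.
pose U := (past_events W S drop m `|` noise_events W m `|` state_events S m.+1).
have HI X Y : H m X -> H m Y -> H m (X `&` Y).
  exact: (@measurableI _ (g_sigma_algebraType U)).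
have FH X : F m X -> H m X.
  by move=> FX; apply: sigma_noise_state; exact: sigma_past_noise.
apply: (HI _ _); first apply: (HI _ _); first apply: (HI _ _).
- exact: FH.
- by apply: FH; exact: sigma_past_state.
- by apply: sub_sigma_algebra; right; exists s'.
- by apply: sigma_noise_state; exact: sigma_error_before.
Qed.

Lemma transition_step m C s s' B : F m C -> measurable B ->
  P (sub_event m s s' B C) =
  (transition Sy s s')%:E * P (C `&` S m @^-1` [set s] `&` E m @^-1` B).
Proof.
move=> FC mB; have [_ _ _ [_ hS _]] := hproc.
rewrite /sub_event setIAC hS; last first.
  apply: (@measurableI _ (g_sigma_algebraType
    (past_events W S drop m `|` noise_events W m))).
    apply: sigma_past_noise.
    apply: (@measurableI _
    (g_sigma_algebraType (past_events W S drop m))) => //.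
    exact: sigma_past_state.
  exact: sigma_error_before.
rewrite -integral_cst; last first.
  apply: measurableI; first apply: measurableI => //.
    exact: sigma_past_measurable FC.
  by rewrite -[X in measurable X]setTI; exact: measurable_error_before.
by apply: eq_integral => w; rewrite inE => -[[_ /= ->]].
Qed.

(** The probability of a drop is an integral of the same function of the error at both times.
    Reception has no clause of its own and is obtained by subtraction, all probabilities being
    finite. *)
Lemma scaled_key q B : measurable B ->
  P (A `&` key n @^-1` [set q] `&` E n @^-1` B) =
  u%:E * P (A' `&` key n' @^-1` [set q] `&` E n' @^-1` B).
Proof.
case: q => [[s s'] b] mB.
have [_ _ _ [_ _ hD]] := hproc.
have scaled_sub B1 : measurable B1 ->
    P (sub_event n s s' B1 A) = u%:E * P (sub_event n' s s' B1 A').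
  by move=> mB1; rewrite !transition_step// scaled_error_before// muleCA.
have msub m C : F m C -> measurable (sub_event m s s' B C).
  by move=> FC; apply: (@sigma_state_measurable m); exact: sub_eventH.
have keyE m C b' : C `&` key m @^-1` [set (s, s', b')] `&` E m @^-1` B =
    sub_event m s s' B C `&` drop m @^-1` [set b'].
  apply/seteqP; split => w; rewrite /key /=.
    by case=> [[Cw [<- <- <-]] Bw].
  by case=> [[[[Cw <-] <-] Bw] <-].
have dropT m : drop m @^-1` [set true] = [set w | drop m w].
  by apply/seteqP; split.
have scaled_drop : P (sub_event n s s' B A `&` drop n @^-1` [set true]) =
    u%:E * P (sub_event n' s s' B A' `&` drop n' @^-1` [set true]).
  rewrite !dropT !hD; [|exact: sub_eventH..].
  (* With both channel states fixed, the drop probability is a function of the pre-decision error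
     alone. *)
  pose f x := (drop_prob Sy s' (threshold_strategy Sy k x s))%:E.
  have fE m C : \int[P]_(w in sub_event m s s' B C)
      (drop_prob Sy (S m.+1 w) (control Sy k W S drop m w))%:E =
      \int[P]_(w in sub_event m s s' B C) f (E m w).
    by apply: eq_integral => w; rewrite inE /f => -[[[_ /= <-] <-] _].
  rewrite !fE; apply: integral_scaled_law => //.
  - exact: measurable_error_before.
  - exact: measurable_error_before.
  - exact: msub.
  - exact: msub.
  - have subI m C B1 : sub_event m s s' B C `&` E m @^-1` B1 =
        sub_event m s s' (B `&` B1) C.
      by rewrite /sub_event preimage_setI setIA.
    by move=> B1 mB1; rewrite !subI; apply: scaled_sub; exact: measurableI.
  - by apply/measurable_EFinP; exact: measurable_threshold_strategy.
  - by move=> x; rewrite lee_fin; exact: drop_prob_strategy_ge0.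
rewrite !keyE; case: b => //.
have split_drop m C : F m C ->
    P (sub_event m s s' B C `&` drop m @^-1` [set false]) =
    P (sub_event m s s' B C) -
      P (sub_event m s s' B C `&` drop m @^-1` [set true]).
  move=> FC; rewrite (@measure_partition _ T R bool P (drop m) _ _ (msub _ _ FC)).
    rewrite big_bool /= [X in _ = X - _]addeC addeK// fin_num_measure//.
    apply: measurableI; first exact: msub.
    by rewrite -[X in measurable X]setTI; exact: measurable_funPT.
  by move=> i; rewrite -[X in measurable X]setTI; exact: measurable_funPT.
by rewrite !split_drop// scaled_sub// scaled_drop muleBr// fin_num_adde_defr//
  fin_num_measure//; exact: msub.
Qed.

Lemma scaled_error_after s' B : measurable B ->
  P (A `&` S n.+1 @^-1` [set s'] `&` e n.+1 @^-1` B) =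
  u%:E * P (A' `&` S n'.+1 @^-1` [set s'] `&` e n'.+1 @^-1` B).
Proof.
move=> mB.
(* The pre-decision errors that, under the key [q], lead to the state [s'] and to an error in
   [B]. *)
pose Bq (q : SS * SS * bool) : set R :=
  [set x | q.1.2 = s' /\ B (if q.2 then x else 0%R)].
have mBq q : measurable (Bq q).
  rewrite /Bq; have [<-|sq] := pselect (q.1.2 = s'); last first.
    by rewrite (_ : [set _ | _] = set0)// -subset0 => x [].
  case: q.2.
    by rewrite (_ : [set _ | _] = B)//; apply/seteqP; split=> [x []|].
  have [B0|B0] := pselect (B 0%R).
    by rewrite (_ : [set _ | _] = setT)//; apply/seteqP; split.
  by rewrite (_ : [set _ | _] = set0)// -subset0 => x [].
have part m C : F m C -> P (C `&` S m.+1 @^-1` [set s'] `&` e m.+1 @^-1` B) =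
    \sum_q P (C `&` key m @^-1` [set q] `&` E m @^-1` Bq q).
  move=> FC; rewrite (@measure_partition _ T R _ P (key m) _ (@mkey m)).
    apply: eq_bigr => q _; congr (P _); apply/seteqP; split => w /=.
      move=> [[[Cw Sw] Bw] kq]; split => //.
      by rewrite /Bq /= -kq /=; split.
    by move=> [[Cw kq]]; rewrite /Bq /= -kq /= => -[].
  apply: measurableI; first apply: measurableI => //.
    exact: sigma_past_measurable FC.
  by rewrite -[X in measurable X]setTI; exact: measurable_error_after.
rewrite !part// ge0_sume_distrr//.
by apply: eq_bigr => q _; exact: scaled_key.
Qed.

Lemma scaled_step_cost :
  \int[P]_(w in A) (c n w)%:E = u%:E * \int[P]_(w in A') (c n' w)%:E.
Proof.
have part m C : F m C -> \int[P]_(w in C) (c m w)%:E =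
    \sum_q \int[P]_(w in C `&` key m @^-1` [set q]) (cost_of q (E m w))%:E.
  move=> FC; rewrite (@integral_partition _ T R _ P (key m) _ _ (@mkey m)).
  - apply: eq_bigr => q _; apply: eq_integral => w.
    by rewrite inE step_costE => -[_ /= ->].
  - exact: sigma_past_measurable FC.
  - apply/measurable_EFinP; apply: measurable_funTS.
    exact: measurable_step_cost.
  - by move=> w; rewrite lee_fin step_cost_ge0.
rewrite !part// ge0_sume_distrr; last first.
  by move=> q _; apply: integral_ge0 => w _; rewrite lee_fin.
apply: eq_bigr => q _.
apply: (@integral_scaled_law _ T R _ R P P (E n) (E n') _ _ u
  (EFin \o cost_of q)) => //.
- exact: measurable_error_before.
- exact: measurable_error_before.
- by apply: measurableI => //; exact: sigma_past_measurable FA.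
- by apply: measurableI => //; exact: sigma_past_measurable FA'.
- by move=> B mB; exact: scaled_key.
- by apply/measurable_EFinP.
- by move=> x; rewrite lee_fin.
Qed.

End step.

(** * Visits, excursions and regeneration *)

Definition visit t := [set w | e t w = 0 /\ S t w = s0].

(** Excluding one visit at a time keeps [excursion s j] inside [F (s + j)] and lets regeneration be
    proved by induction on [j]. *)
Fixpoint excursion (s j : nat) : set T :=
  if j is j'.+1 then excursion s j' `&` ~` visit (s + j) else visit s.

Lemma sigma_visit t : F t (visit t).
Proof.
apply: (@measurableI _ (g_sigma_algebraType (past_events W S drop t))).
  exact: (@sigma_error_after t [set 0]).
exact: sigma_past_state.
Qed.

Lemma sigma_excursion s j : F (s + j) (excursion s j).
Proof.
elim: j => [|j IHj] /=; first by rewrite addn0; exact: sigma_visit.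
pose U := past_events W S drop (s + j.+1).
apply: (@measurableI _ (g_sigma_algebraType U)).
  by apply: sigma_past_le IHj; rewrite leq_add2l.
apply: (@measurableC _ (g_sigma_algebraType U)).
exact: sigma_visit.
Qed.

Lemma measurable_excursion s j : measurable (excursion s j).
Proof. exact: sigma_past_measurable (@sigma_excursion s j). Qed.

Lemma visit0 : visit 0 = setT.
Proof. by apply/seteqP; split => // w _; split => //; exact: S0. Qed.

Lemma excursionP s j w : excursion s j w <->
  visit s w /\ forall i, (s < i <= s + j)%N -> ~ visit i w.
Proof.
elim: j => [|j IHj].
  rewrite addn0; split => [Vw|[]//].
  by split => // i /andP[si is_]; have := leq_trans si is_; rewrite ltnn.
split => [/= [/IHj[Vs HV] nV]|[Vs HV] /=].
  split=> // i /andP[si]; rewrite leq_eqVlt => /orP[/eqP -> //|].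
  by rewrite addnS ltnS => ij; apply: HV; rewrite si.
split; last by apply: HV; rewrite leqnn andbT addnS ltnS leq_addr.
apply/IHj; split => // i /andP[si ij]; apply: HV; rewrite si/=.
by rewrite (leq_trans ij)// leq_add2l.
Qed.

Local Open Scope ereal_scope.

Definition visit_probability s := fine (P (visit s)).

Lemma visit_probability_ge0 s : (0 <= visit_probability s)%R.
Proof. by apply: fine_ge0; exact: measure_ge0. Qed.

Lemma visit_probabilityE s : P (visit s) = (visit_probability s)%:E.
Proof.
rewrite fineK// fin_num_measure//.
exact: sigma_past_measurable (@sigma_visit s).
Qed.

(** At a visit the state is exactly [(0, s0)], so for [j = 0] both sides are the visit probability
    or zero. The one-step kernel then propagates the proportionality. *)
Lemma scaled_excursion s j s' B : measurable B ->
  P (excursion s j `&` S (s + j) @^-1` [set s'] `&` e (s + j) @^-1` B) =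
  (visit_probability s)%:E *
    P (excursion 0 j `&` S j @^-1` [set s'] `&` e j @^-1` B).
Proof.
elim: j s' B => [|j IHj] s' B mB.
  rewrite addn0 [excursion 0 0]visit0 setTI /=.
  have [[-> B0]|nB] := pselect (s' = s0 /\ B 0%R).
    rewrite (_ : visit s `&` _ `&` _ = visit s); last first.
      by apply/seteqP; split => [w [[]]//|w [e0 Sw]]; split => //=; rewrite e0.
    rewrite (_ : _ `&` _ = setT) ?probability_setT ?mule1 ?visit_probabilityE//.
    by apply/seteqP; split => // w _; split => //=; exact: S0.
  rewrite (_ : visit s `&` _ `&` _ = set0); last first.
    rewrite -subset0 => w [[[e0 Sw] /= Sw'] Bw]; apply: nB.
    by rewrite -e0; split => //; rewrite -Sw'.
  rewrite (_ : _ `&` _ = set0) ?measure0 ?mule0//.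
  by rewrite -subset0 => w [/= Sw Bw]; apply: nB; split => //; rewrite -Sw S0.
(* Deleting [0] when [s'] is [s0] says that the new time is not a visit. The exclusion moves from
   the event to the target set, where the one-step result applies. *)
pose B' : set R := [set x | B x /\ ~ (x = 0%R /\ s' = s0)].
have mB' : measurable B'.
  have [ss|ss] := pselect (s' = s0).
    rewrite (_ : B' = B `\` [set 0%R]); first exact: measurableD.
    apply/seteqP; split => x [Bx x0]; split => //; first by move=> ?; exact: x0.
    by move=> [? _]; exact: x0.
  rewrite (_ : B' = B)//.
  by apply/seteqP; split => x; [case|split => // -[]].
have capE m t : excursion m t `&` ~` visit (m + t.+1) `&`
      S (m + t.+1) @^-1` [set s'] `&` e (m + t.+1) @^-1` B =
    excursion m t `&` S (m + t.+1) @^-1` [set s'] `&` e (m + t.+1) @^-1` B'.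
  apply/seteqP; split => w /=.
    by move=> [[[Cw nV] Sw] Bw]; split => //; split => // -[e0 ss]; apply: nV;
      split => //; rewrite Sw.
  move=> [[Cw Sw] [Bw nV]]; split => //; split => //; split => // -[e0 Sw'].
  by apply: nV; split => //; rewrite -Sw.
have /= := capE 0%N j; rewrite add0n => ->; rewrite /= capE addnS.
by apply: (scaled_error_after (@sigma_excursion s j) (@sigma_excursion 0 j)
  (visit_probability_ge0 s) IHj).
Qed.

Lemma scaled_excursion_cost s j :
  \int[P]_(w in excursion s j) (c (s + j) w)%:E =
  (visit_probability s)%:E * \int[P]_(w in excursion 0 j) (c j w)%:E.
Proof.
exact: (scaled_step_cost (@sigma_excursion s j) (@sigma_excursion 0 j)
  (visit_probability_ge0 s) (@scaled_excursion s j)).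
Qed.

Lemma scaled_excursion_probability s j :
  P (excursion s j) = (visit_probability s)%:E * P (excursion 0 j).
Proof.
rewrite (@measure_partition _ T R _ P (S (s + j))%N _ (@mS (s + j)))//;
  last exact: measurable_excursion.
rewrite (@measure_partition _ T R _ P (S j) (excursion 0 j) (@mS j))//;
  last exact: measurable_excursion.
rewrite ge0_sume_distrr//; apply: eq_bigr => s' _.
have := @scaled_excursion s j s' setT measurableT.
by rewrite !preimage_setT !setIT.
Qed.

(** Time [0] is always a visit, so [ord0] is a legitimate candidate and the maximum exists. *)
Let last_visit t w : 'I_t.+1 := [arg max_(i > ord0 | `[< visit i w >]) i]%N.

Let last_visitE t i : last_visit t @^-1` [set i] = excursion i (t - i).
Proof.
have it : (i + (t - i) = t)%N by rewrite subnKC// -ltnS.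
have V0 w : `[< visit (@ord0 t) w >] by apply/asboolP; rewrite visit0.
apply/seteqP; split => w /=.
  rewrite /last_visit; case: arg_maxnP => //= j /asboolP Vj jmax ji.
  apply/excursionP; split => [|l]; first by rewrite -ji.
  rewrite it => /andP[il lt] Vl.
  have := jmax (Ordinal (lt : (l < t.+1)%N)) (asboolT Vl).
  by rewrite leqNgt ji /= il.
move=> /excursionP[Vi]; rewrite it => HV.
rewrite /last_visit; case: arg_maxnP => //= j /asboolP Vj jmax.
apply/val_inj/eqP; rewrite /= eqn_leq; apply/andP; split; last first.
  exact: jmax (asboolT Vi).
rewrite leqNgt; apply/negP => ij; apply: (HV j) => //.
by rewrite ij -ltnS ltn_ord.
Qed.

(** The fibres of [last_visit t] are excursions of length [t - s] from [s], and regeneration turns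
    each term into a product. *)
Lemma last_visit_cost t :
  \int[P]_w (c t w)%:E =
  \sum_(s < t.+1) (visit_probability s)%:E *
    \int[P]_(w in excursion 0 (t - s)) (c (t - s) w)%:E.
Proof.
rewrite (@integral_partition _ T R _ P (last_visit t))//.
- apply: eq_bigr => i _; rewrite setTI last_visitE -scaled_excursion_cost.
  by rewrite subnKC// -ltnS.
- by move=> i; rewrite last_visitE; exact: measurable_excursion.
- by apply/measurable_EFinP; exact: measurable_step_cost.
- by move=> w; rewrite lee_fin step_cost_ge0.
Qed.

Lemma last_visit_probability t :
  1 = \sum_(s < t.+1) (visit_probability s)%:E * P (excursion 0 (t - s)).
Proof.
rewrite -(probability_setT P) (@measure_partition _ T R _ P (last_visit t))//.
  apply: eq_bigr => i _.
  by rewrite setTI last_visitE -scaled_excursion_probability.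
by move=> i; rewrite last_visitE; exact: measurable_excursion.
Qed.

Lemma lt_revisit_time t w :
  ((t%:R)%:E < revisit_time Sy s0 W S drop 1 w) = `[< excursion 0 t w >].
Proof.
apply/idP/asboolP => [tinf|].
  apply/excursionP; split; first by rewrite visit0.
  rewrite add0n => i /andP[i0 it] Vi.
  have : revisit_time Sy s0 W S drop 1 w <= (i%:R)%:E.
    by apply: ereal_inf_lbound; exists i => //; split; rewrite // lte_fin ltr0n.
  by rewrite leNgt (le_lt_trans _ tinf)// lee_fin ler_nat.
move=> /excursionP[_ HV].
(* Every revisit comes at [t.+1] or later, so the infimum is at least [t.+1], even over the empty
   set. *)
apply: (@lt_le_trans _ _ (t.+1%:R)%:E); first by rewrite lte_fin ltr_nat.
apply: le_ereal_inf_tmp => _ [i [i0 Vi] <-].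
rewrite lee_fin ler_nat ltnNge; apply/negP => it; apply: (HV i) => //.
by rewrite add0n it andbT -(@ltr0n R).
Qed.

(** The random range of summation becomes the indicator of excursions from time [0]; then integral
    and nonnegative series are exchanged. *)
Lemma integral_before_revisit (y : nat -> T -> R) :
  (forall t w, 0 <= y t w)%R -> (forall t, measurable_fun setT (y t)) ->
  \int[P]_w (\sum_(0 <= t <oo | (t%:R)%:E < revisit_time Sy s0 W S drop 1 w)
              (y t w)%:E) =
  \sum_(t <oo) \int[P]_(w in excursion 0 t) (y t w)%:E.
Proof.
move=> y0 my.
pose z t := (fun w => (y t w)%:E) \_ (excursion 0 t).
under eq_integral => w _.
  rewrite eseries_mkcond (@eq_eseriesr _ _ (fun t => z t w)); last first.
    move=> t _; rewrite /z patchE lt_revisit_time.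
    by case: asboolP => [ew|ew]; [rewrite mem_set|rewrite memNset].
  over.
rewrite /= integral_nneseries//.
- by apply: eq_eseriesr => t _; rewrite [RHS]integral_mkcond.
- move=> t; apply/(measurable_restrictT _ (measurable_excursion 0 t)).
  by apply: measurable_funTS; apply/measurable_EFinP.
- by move=> t w _; rewrite /z patchE; case: ifP => //; rewrite lee_fin.
Qed.

End process_lemmas.

(** * Renewal sequences *)

Section renewal.
Context (R : realType).
Local Open Scope ereal_scope.

Definition convolution (x : nat -> R) (y : nat -> \bar R) (t : nat) : \bar R :=
  \sum_(s < t.+1) (x s)%:E * y (t - s)%N.

Lemma convolution_ge0 x y t : (forall s, 0 <= x s)%R -> (forall j, 0 <= y j) ->
  0 <= convolution x y t.
Proof. by move=> x0 y0; apply: sume_ge0 => s _; rewrite mule_ge0 ?lee_fin. Qed.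

Lemma sum_convolution x y N : (forall j, 0 <= y j) ->
  \sum_(0 <= t < N) convolution x y t =
  \sum_(0 <= s < N) (x s)%:E * \sum_(0 <= j < N - s) y j.
Proof.
move=> y0; elim: N => [|N IHN]; first by rewrite !big_geq.
rewrite big_nat_recr//= IHN /convolution big_ord_recr/= subnn.
rewrite -(big_mkord xpredT (fun s => (x s)%:E * y (N - s)%N)).
rewrite [RHS]big_nat_recr//= subSnn big_nat1 addeA -big_split/=; congr (_ + _).
apply: eq_big_nat => s /andP[_ sN]; rewrite subSn 1?ltnW// big_nat_recr//=.
by rewrite ge0_muleDr// sume_ge0.
Qed.

Lemma le_sum_nneseries (y : nat -> \bar R) N : (forall j, 0 <= y j) ->
  \sum_(0 <= j < N) y j <= \sum_(j <oo) y j.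
Proof. by move=> y0; apply: nneseries_lim_ge. Qed.

Lemma nneseries_le (y : nat -> \bar R) c N0 : (forall j, 0 <= y j) ->
  (forall N, (N0 <= N)%N -> \sum_(0 <= j < N) y j <= c) ->
  \sum_(j <oo) y j <= c.
Proof.
move=> y0 yc; apply: lime_le; first exact: is_cvg_nneseries.
by exists N0 => // n /= Nn; exact: yc.
Qed.

Lemma sum_convolution_le x y N : (forall s, 0 <= x s)%R ->
  (forall j, 0 <= y j) ->
  \sum_(0 <= t < N) convolution x y t <=
  (\sum_(0 <= s < N) x s)%:E * \sum_(j <oo) y j.
Proof.
move=> x0 y0; rewrite sum_convolution// -sumEFin ge0_sume_distrl; last first.
  by move=> s _; rewrite lee_fin.
by apply: lee_sum => s _; rewrite lee_wpmul2l ?lee_fin// le_sum_nneseries.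
Qed.

(** All pairs [s < n], [j < K] satisfy [s + j < n + K], and the other terms are nonnegative. *)
Lemma sum_convolution_ge x y n K : (forall s, 0 <= x s)%R ->
  (forall j, 0 <= y j) ->
  (\sum_(0 <= s < n) x s)%:E * \sum_(0 <= j < K) y j <=
  \sum_(0 <= t < n + K) convolution x y t.
Proof.
move=> x0 y0; rewrite sum_convolution// -sumEFin ge0_sume_distrl; last first.
  by move=> s _; rewrite lee_fin.
rewrite [leRHS](@big_cat_nat _ _ _ n)//= ?leq_addr//.
rewrite -[leLHS]adde0 leeD//; last first.
  by apply: sume_ge0 => s _; rewrite mule_ge0 ?lee_fin// sume_ge0.
rewrite !big_nat; apply: lee_sum => s /andP[_ sn].
rewrite lee_wpmul2l ?lee_fin//.
by rewrite -big_nat lee_sum_nneg_natr// -addnBAC ?leq_addl// ltnW.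
Qed.

Lemma nneseries_convolution x y : (forall s, 0 <= x s)%R -> (0 < x 0%N)%R ->
  (forall j, 0 <= y j) ->
  \sum_(t <oo) convolution x y t =
  (\sum_(s <oo) (x s)%:E) * \sum_(j <oo) y j.
Proof.
move=> x0 x00 y0; have c0 t : 0 <= convolution x y t.
  exact: convolution_ge0.
have X0 n : (0 <= \sum_(0 <= s < n) x s)%R by rewrite sumr_ge0.
have Y0 : 0 <= \sum_(j <oo) y j by exact: nneseries_ge0.
apply/eqP; rewrite eq_le; apply/andP; split.
  apply: (nneseries_le (N0 := 0)) => // N _.
  apply: le_trans (sum_convolution_le _ _ _) _ => //.
  rewrite lee_wpmul2r// -sumEFin; apply: le_sum_nneseries => s.
  by rewrite lee_fin.
have H n : (\sum_(0 <= s < n) x s)%:E * \sum_(j <oo) y j <=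
    \sum_(t <oo) convolution x y t.
  rewrite -nneseriesZl//; apply: (nneseries_le (N0 := 0)) => [j|N _].
    by rewrite mule_ge0// lee_fin.
  rewrite -ge0_sume_distrr//.
  exact: le_trans (sum_convolution_ge _ _ _ _) (le_sum_nneseries _ _).
have [Yfin|] := boolP (\sum_(j <oo) y j \is a fin_num).
  rewrite -(fineK Yfin) muleC -nneseriesZl; last by move=> *; rewrite lee_fin.
  apply: (nneseries_le (N0 := 0)) => [s|N _].
    by rewrite mule_ge0 ?lee_fin// fine_ge0.
  rewrite -ge0_sume_distrr; last by move=> *; rewrite lee_fin.
  by rewrite sumEFin muleC fineK.
(* When the second factor is infinite, the term [s = 0] with [0 < x 0] alone makes the convolution
   series infinite. *)
rewrite ge0_fin_numE// -leNgt leye_eq => /eqP Yy.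
have := H 1%N; rewrite Yy big_nat1 gt0_muley ?lte_fin// leye_eq => /eqP ->.
exact: leey.
Qed.

(* The bounds [lo K] and [hi K] are attained only in the limit over K, which is
   taken here through order properties of their limits rather than by a
   diagonal argument. *)
Lemma cvge_sandwich (v : nat -> \bar R) (lo hi : nat -> nat -> \bar R)
    (b t : nat -> \bar R) (l : \bar R) :
  (forall K, lo K n @[n --> \oo] --> b K) ->
  (forall K, \forall n \near \oo, lo K n <= v n) ->
  (forall c, (forall K, b K <= c) -> l <= c) ->
  (forall K, hi K n @[n --> \oo] --> t K) ->
  (forall K, \forall n \near \oo, v n <= hi K n) ->
  (forall c, (forall K, c <= t K) -> c <= l) ->
  v n @[n --> \oo] --> l.
Proof.
move=> lob lov bl hit vhi tl.
have li : l <= limn (einfs v).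
  apply: bl => K; rewrite -(cvg_lim _ (cvg_einfs (lob K)))//.
  apply: lee_lim; [exact: is_cvg_einfs|exact: is_cvg_einfs|].
  have [N _ HN] := lov K; exists N => // n /= Nn.
  apply: le_ereal_inf_tmp => _ [m /= nm <-].
  by apply: ge_ereal_inf; exists (lo K m);
    [exists m|exact: HN (leq_trans Nn nm)].
have sl : limn (esups v) <= l.
  apply: tl => K; rewrite -(cvg_lim _ (cvg_esups (hit K)))//.
  apply: lee_lim; [exact: is_cvg_esups|exact: is_cvg_esups|].
  have [N _ HN] := vhi K; exists N => // n /= Nn.
  apply: ge_ereal_sup => _ [m /= nm <-].
  apply: le_trans (HN m (leq_trans Nn nm)) _.
  by apply: ereal_sup_ubound; exists m.
have is_ : limn (einfs v) <= limn (esups v).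
  by rewrite -limn_einf_lim -limn_esup_lim; exact: limn_einf_sup.
have iE : limn (einfs v) = l.
  by apply/eqP; rewrite eq_le li (le_trans is_).
have sE : limn (esups v) = l.
  by apply/eqP; rewrite eq_le sl (le_trans li).
apply: (@squeeze_cvge _ _ _ _ (einfs v) _ (esups v)).
- apply: nearW => n; apply/andP; split.
    by apply: ereal_inf_lbound; exists n => //=.
  by apply: ereal_sup_ubound; exists n => //=.
- by rewrite -iE; exact: is_cvg_einfs.
- by rewrite -sE; exact: is_cvg_esups.
Qed.

(** * Discounted and average renewal theorems *)

Section renewal_theorem.
Variables (u g : nat -> R) (r : nat -> \bar R).
Hypotheses (u_ge0 : forall s, (0 <= u s)%R) (u_le1 : forall s, (u s <= 1)%R).
Hypotheses (u0 : u 0%N = 1%R) (g_ge0 : forall j, (0 <= g j)%R).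
Hypothesis r_ge0 : forall j, 0 <= r j.
Hypothesis renewal : forall t, convolution u (EFin \o g) t = 1.

Let g0 : g 0%N = 1%R.
Proof.
have := renewal 0; rewrite /convolution big_ord1 /= u0 mul1e subnn.
by case.
Qed.

Let geom_convolution (beta : R) (y : nat -> \bar R) t : (0 <= beta)%R ->
  (forall j, 0 <= y j) ->
  convolution (fun s => beta ^+ s * u s)%R (fun j => (beta ^+ j)%:E * y j) t =
  (beta ^+ t)%:E * convolution u y t.
Proof.
move=> b0 y0; rewrite /convolution ge0_sume_distrr; last first.
  by move=> s _; rewrite mule_ge0 ?lee_fin.
apply: eq_bigr => s _; rewrite EFinM muleACA -EFinM -exprD subnKC// -ltnS.
exact: ltn_ord.
Qed.

Theorem discounted_renewal (beta : R) : (0 < beta)%R -> (beta < 1)%R ->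
  (1 - beta)%:E * \sum_(t <oo) (beta ^+ t)%:E * convolution u r t =
  (\sum_(t <oo) (beta ^+ t)%:E * r t) / (\sum_(t <oo) (beta ^+ t * g t)%:E).
Proof.
move=> b0 b1.
have conv (y : nat -> \bar R) : (forall j, 0 <= y j) ->
  \sum_(t <oo) (beta ^+ t)%:E * convolution u y t =
  (\sum_(s <oo) (beta ^+ s * u s)%:E) * \sum_(j <oo) (beta ^+ j)%:E * y j.
  move=> y0; rewrite -nneseries_convolution.
  - by apply: eq_eseriesr => t _; rewrite geom_convolution// ltW.
  - by move=> s; rewrite mulr_ge0// exprn_ge0// ltW.
  - by rewrite expr0 u0 mulr1.
  - by move=> j; rewrite mule_ge0// lee_fin exprn_ge0// ltW.
set U := \sum_(s <oo) (beta ^+ s * u s)%:E in conv.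
set M := \sum_(t <oo) (beta ^+ t * g t)%:E.
have term_ge0 (x : nat -> R) j : (forall s, 0 <= x s)%R ->
    0 <= (beta ^+ j * x j)%:E.
  by move=> x0; rewrite lee_fin mulr_ge0// exprn_ge0// ltW.
(* The renewal equation makes the convolution of [u] and [g] identically one, which leaves the
   geometric series. *)
have UM : U * M = ((1 - beta)^-1)%:E.
  rewrite /M; under eq_eseriesr do rewrite EFinM.
  rewrite -(conv (EFin \o g))//.
  under eq_eseriesr do rewrite renewal mule1.
  apply/cvg_lim => //; under eq_fun do rewrite sumEFin.
  apply: cvg_EFin; first exact: nearW.
  have -> : fine \o (fun n => (\sum_(0 <= i < n) beta ^+ i)%:E) =
      series (geometric 1 beta)%R.
    apply/funext => n /=; rewrite /series /=; apply: eq_bigr => i _.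
    by rewrite /geometric /= mul1r.
  rewrite -[X in _ --> X]mul1r; apply: cvg_geometric_series.
  by rewrite ger0_norm// ltW.
have U1 : 1 <= U.
  apply: le_trans (le_sum_nneseries 1 _); last by move=> j; exact: term_ge0.
  by rewrite big_nat1 expr0 mul1r u0.
have M1 : 1 <= M.
  apply: le_trans (le_sum_nneseries 1 _); last by move=> j; exact: term_ge0.
  by rewrite big_nat1 expr0 mul1r g0.
have U0 : 0 < U := lt_le_trans lte01 U1.
have M0 : 0 < M := lt_le_trans lte01 M1.
rewrite conv//.
move: UM U0 M0; case: (U) => [x| |]; case: (M) => [m| |] //; last first.
(* The product of [U] and [M] is finite and both are positive, so neither is infinite; the cost
   series still may be. *)
- by move=> + _ m0; rewrite gt0_mulye.
- by move=> + x0 _; rewrite gt0_muley.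
move=> [xm]; rewrite !lte_fin => x0 m0.
rewrite inver gt_eqF// muleA -EFinM [RHS]muleC; congr (_%:E * _).
have b1' : (1 - beta != 0)%R by rewrite subr_eq0 gt_eqF.
apply: (mulIf (lt0r_neq0 m0)); rewrite -mulrA xm divff// mulVf//.
exact: lt0r_neq0.
Qed.

(** The visit rate converges to [M^-1] first, which is [0] when [M] is infinite, and the average
    cost is squeezed by multiples of that rate. Excluding [L = M = +oo] keeps the products of limits
    away from zero times infinity. *)
Theorem average_renewal : let M := \sum_(t <oo) (g t)%:E in
  let L := \sum_(t <oo) r t in ~ (L = +oo /\ M = +oo) ->
  ((n%:R^-1)%:E * \sum_(0 <= t < n) convolution u r t) @[n --> \oo] --> L / M.
Proof.
move=> M L LM.
pose A n := (\sum_(0 <= s < n) u s)%R.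
pose G K := (\sum_(0 <= j < K) g j)%R.
pose Rs K := \sum_(0 <= j < K) r j.
have G1 K : (1 <= G K.+1)%R.
  by rewrite /G big_nat_recl//= g0 lerDl sumr_ge0.
have GM K : (G K)%:E <= M.
  by rewrite /G -sumEFin; apply: le_sum_nneseries => j; rewrite lee_fin.
have M1 : 1 <= M by apply: le_trans (GM 1%N); rewrite lee_fin.
have M0 : 0 <= M by apply: le_trans M1.
have L0 : 0 <= L by exact: nneseries_ge0.
have A0 n : (0 <= A n)%R by exact: sumr_ge0.
have rho_fin : M^-1 \is a fin_num.
  rewrite ge0_fin_numE ?inve_ge0// (le_lt_trans _ (ltry 1))//.
  by rewrite inve_ple ?inE// inve1.
have renewal_sum n : \sum_(0 <= t < n) convolution u (EFin \o g) t = n%:R%:E.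
  under eq_bigr do rewrite renewal.
  by rewrite sumEFin big_const_nat subn0 iter_addr_0.
have inv_cvg (x : R) : ((x * n%:R^-1)%:E @[n --> \oo] --> 0).
  apply: cvg_EFin; first exact: nearW.
  rewrite -(mulr0 x); apply: cvgMr; rewrite -cvg_shiftS.
  exact: cvg_harmonic.
(* The lower bound comes from [n <= A n * M], the upper one from [A n * G K.+1 <= n + K.+1]. The
   index [K.+1] makes [G] at least [1], hence invertible. *)
have Acvg : (n%:R^-1 * A n)%:E @[n --> \oo] --> M^-1.
  apply: (@cvge_sandwich _ (fun=> fun=> M^-1)
    (fun K n => (((G K.+1)^-1)%:E + (K.+1%:R * (G K.+1)^-1 * n%:R^-1)%:E))
    (fun=> M^-1) (fun K => ((G K.+1)^-1)%:E)).
  - by move=> K; exact: cvg_cst.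
  - move=> _; exists 1%N => // n /= n0.
    have : n%:R%:E <= (A n)%:E * M.
      by rewrite -renewal_sum sum_convolution_le// => j; rewrite lee_fin.
    have n0' : (0 < n%:R :> R)%R by rewrite ltr0n.
    move: M1; case: (M) => [m| |] //; last first.
      by move=> _ _; rewrite invey lee_fin mulr_ge0// invr_ge0.
    rewrite lee_fin => m1; have m0 : (0 < m)%R by apply: lt_le_trans m1.
    rewrite inver gt_eqF// -EFinM !lee_fin => nAm.
    by rewrite mulrC ler_pdivlMr// mulrC ler_pdivrMr.
  - by move=> c; apply; exact: 0%N.
  - move=> K; rewrite -[X in _ --> X]adde0; apply: cvgeD => //.
    exact: cvg_cst.
  - move=> K; exists 1%N => // n /= n0.
    have n0' : (0 < n%:R :> R)%R by rewrite ltr0n.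
    have := @sum_convolution_ge u (EFin \o g) n K.+1 u_ge0.
    rewrite renewal_sum sumEFin -EFinM lee_fin natrD => H.
    have {H} AG : (A n * G K.+1 <= n%:R + K.+1%:R)%R.
      by apply: H => j; rewrite lee_fin.
    have G0 : (0 < G K.+1)%R by apply: lt_le_trans (G1 K).
    rewrite -EFinD lee_fin (_ : _ + _ = n%:R^-1 *
        ((n%:R + K.+1%:R) * (G K.+1)^-1))%R; last first.
      by rewrite mulrDl mulrDr mulKf ?gt_eqF// [in RHS]mulrC.
    by rewrite ler_wpM2l ?invr_ge0// ler_pdivlMr.
  (* Inversion reverses the order only among nonnegative numbers, so a negative [c] is treated
     apart. *)
  - move=> c cG; have [c0|c0] := leP 0 c; last first.
      by apply: le_trans (ltW c0) _; rewrite inve_ge0.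
    rewrite inve_pge ?inE//; apply: (nneseries_le (N0 := 1)) => [j|[//|K] _].
      by rewrite lee_fin.
    rewrite sumEFin inve_pge ?inE//; last by rewrite lee_fin sumr_ge0.
    rewrite inver gt_eqF; first exact: cG.
    exact: lt_le_trans (G1 K).
set rho := fine M^-1; have rhoE : M^-1 = rho%:E by rewrite fineK.
have rho0 : (0 <= rho)%R by rewrite -lee_fin -rhoE inve_ge0.
(* An infinite [y] forces [L = +oo], while [rho = 0] forces [M = +oo]; the two together are
   excluded. *)
have rhoL y : 0 <= y -> y <= L -> rho%:E *? y.
  case: y => [y| |] //= _; rewrite leye_eq => /eqP Ly; apply/eqP => rho0'.
  apply: LM; split=> //; apply/eqP.
  by rewrite -inve_eq0 rhoE rho0'.
have RL K : Rs K <= L by exact: le_sum_nneseries.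
have R0 K : 0 <= Rs K by exact: sume_ge0.
(* Since [u] is at most one, a shift by [K] adds at most [K] to [A], which vanishes after division
   by [n]. *)
have AS n K : (A (n + K)%N <= A n + K%:R)%R.
  rewrite /A (@big_cat_nat _ _ _ n)//= ?leq_addr// lerD2l.
  apply: le_trans (ler_sum _ (fun i _ => u_le1 i)) _.
  by rewrite big_const_nat iter_addr_0 addKn.
apply: (@cvge_sandwich _
  (fun K n => (n%:R^-1 * A n - K%:R * n%:R^-1)%:E * Rs K)
  (fun K n => (n%:R^-1 * A n)%:E * L)
  (fun K => rho%:E * Rs K) (fun=> L * rho%:E)).
- move=> K; apply: cvgeM; [exact: rhoL| |exact: cvg_cst].
  rewrite -[rho%:E]sube0; under eq_fun do rewrite EFinB.
  by apply: cvgeB => //; rewrite -rhoE.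
- move=> K; exists K => // n /= Kn.
  (* This case occurs only for [K = 0]; both sides vanish because the inverse of [0] is [0]. *)
  have [->|n0] := eqVneq n 0%N.
    by rewrite invr0 !mul0r mulr0 subr0 mul0e big_geq// mule0.
  have n0' : (0 < n%:R :> R)%R by rewrite ltr0n lt0n.
  apply: (@le_trans _ _ ((n%:R^-1)%:E * ((A (n - K)%N)%:E * Rs K))).
    rewrite muleA -EFinM lee_wpmul2r// lee_fin [(K%:R * _)%R]mulrC -mulrBr.
    by rewrite ler_wpM2l ?invr_ge0// lerBlDr -{1}(subnK Kn).
  rewrite lee_wpmul2l ?lee_fin ?invr_ge0//.
  by rewrite -{2}(subnK Kn); exact: sum_convolution_ge.
- move=> c rc; rewrite rhoE /L muleC -nneseriesZl//.
  apply: (nneseries_le (N0 := 0)) => [j|K _].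
    by rewrite mule_ge0 ?lee_fin.
  by rewrite -ge0_sume_distrr//; exact: rc.
- move=> _; rewrite [L * _]muleC; apply: cvgeM; [exact: rhoL| |exact: cvg_cst].
  by rewrite -rhoE.
- move=> _; apply: nearW => n.
  rewrite EFinM -muleA lee_wpmul2l ?lee_fin ?invr_ge0//.
  exact: sum_convolution_le.
- by move=> c; rewrite rhoE; apply; exact: 0%N.
Qed.

End renewal_theorem.
End renewal.

(** [limn] is total, so for [beta = 1] convergence is asserted separately to make its value a
    genuine limit; [hratio] excludes a quotient of two infinities. The proof feeds visit
    probabilities, excursion costs and excursion probabilities to the renewal theorems. *)
Theorem theorem5 (R : realType) (disp : Order.disp_t) (SS : finOrderType disp)
    (Sy : system R SS) (k : SS -> nat -> \bar R) (hk : thresholds Sy k)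
    (d : measure_display) (T : measurableType d) (P : probability T R)
    (s0 : SS) (W : nat -> {RV P >-> R}) (S : nat -> T -> SS)
    (drop : nat -> {mfun T >-> bool})
    (hproc : post_decision_process Sy k s0 W S drop)
    (beta : R) (hbeta0 : 0 < beta) (hbeta1 : beta <= 1)
    (hratio : beta = 1 -> ~ (cycle_cost Sy k s0 W S drop beta = +oo%E /\
                             cycle_length Sy s0 W S drop beta = +oo%E)) :
  (beta = 1 -> cvgn (average_cost Sy k W S drop)) /\
  performance Sy k W S drop beta =
    (cycle_cost Sy k s0 W S drop beta / cycle_length Sy s0 W S drop beta)%E.
Proof.
pose c t w := step_cost Sy k W S drop t w.
pose u := visit_probability Sy s0 W S drop.
pose exc t := excursion Sy s0 W S drop 0 t.
pose r t := (\int[P]_(w in exc t) (c t w)%:E)%E.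
pose g t := fine (P (exc t)).
have c0 t w : 0 <= c t w by exact: (step_cost_ge0 hk hproc).
have mc t : measurable_fun setT (c t) by exact: (measurable_step_cost hk hproc).
have mcE t : measurable_fun setT (fun w => (c t w)%:E).
  exact/measurable_EFinP.
have mexc t : measurable (exc t) by exact: (measurable_excursion hproc).
have gE t : P (exc t) = (g t)%:E by rewrite fineK// fin_num_measure.
have g0 t : 0 <= g t by rewrite fine_ge0.
have r0 t : (0 <= r t)%E by apply: integral_ge0 => w _; rewrite lee_fin.
have u_ge0 t : 0 <= u t by exact: visit_probability_ge0.
have u_le1 t : u t <= 1.
  rewrite -lee_fin -(visit_probabilityE hproc); apply: probability_le1.
  by apply: (sigma_past_measurable hproc); exact: (sigma_visit hproc).
have u0 : u 0%N = 1.
  by rewrite /u /visit_probability (visit0 hproc) probability_setT.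
have renewal t : convolution u (EFin \o g) t = 1%E.
  rewrite (last_visit_probability hk hproc t).
  by apply: eq_bigr => s _; rewrite /= -gE.
have costE t : (\int[P]_w (c t w)%:E)%E = convolution u r t.
  exact: last_visit_cost.
have b0 t : 0 <= beta ^+ t by rewrite exprn_ge0// ltW.
have cycle_costE : cycle_cost Sy k s0 W S drop beta =
    (\sum_(t <oo) (beta ^+ t)%:E * r t)%E.
  rewrite /cycle_cost.
  rewrite (integral_before_revisit hproc (y := fun t w => beta ^+ t * c t w)).
  - apply: eq_eseriesr => t _; under eq_integral do rewrite EFinM.
    rewrite ge0_integralZl ?lee_fin//; first exact: measurable_funTS.
    by move=> w _; rewrite lee_fin.
  - by move=> t w; rewrite mulr_ge0.
  - by move=> t; exact: measurable_funM.
have cycle_lengthE : cycle_length Sy s0 W S drop beta =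
    (\sum_(t <oo) (beta ^+ t * g t)%:E)%E.
  rewrite /cycle_length.
  rewrite (integral_before_revisit hproc (y := fun t _ => beta ^+ t)) => [|//|t].
  - by apply: eq_eseriesr => t _; rewrite integral_cst//; rewrite EFinM -gE.
  - exact: measurable_cst.
rewrite cycle_costE cycle_lengthE in hratio *.
have [b1|] := ltP beta 1.
  split=> [b|]; first by rewrite b ltxx in b1.
  rewrite /performance b1 -(discounted_renewal u_ge0)//; congr (_ * _)%E.
  rewrite integral_nneseries//.
  - apply: eq_eseriesr => t _; under eq_integral do rewrite EFinM.
    rewrite ge0_integralZl ?lee_fin ?costE// => w _; by rewrite lee_fin.
  - move=> t; apply/measurable_EFinP; exact: measurable_funM.
  - by move=> t w _; rewrite lee_fin mulr_ge0.
move=> b1; have b : beta = 1 by apply/eqP; rewrite eq_le hbeta1.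
have seriesE : ((\sum_(t <oo) (beta ^+ t)%:E * r t) = \sum_(t <oo) r t)%E.
  by apply: eq_eseriesr => t _; rewrite b expr1n mul1e.
have seriesgE : (\sum_(t <oo) (beta ^+ t * g t)%:E = \sum_(t <oo) (g t)%:E)%E.
  by apply: eq_eseriesr => t _; rewrite b expr1n mul1r.
rewrite seriesE seriesgE in hratio *.
have cvg_average := average_renewal u_ge0 u_le1 u0 g0 r0 renewal (hratio b).
(* The expected total over [n] steps is a finite sum of expected costs, each of them a
   convolution. *)
have averageE : average_cost Sy k W S drop =
    (fun n => (n%:R^-1)%:E * \sum_(0 <= t < n) convolution u r t)%E.
  apply/funext => n; rewrite /average_cost; congr (_ * _)%E.
  under eq_integral do rewrite -sumEFin.
  rewrite ge0_integral_sum//; first by apply: eq_bigr => t _; exact: costE.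
  by move=> t w _; rewrite lee_fin.
split=> [_|].
  by rewrite averageE; apply/cvg_ex; eexists; exact: cvg_average.
rewrite /performance ltNge b1/= averageE.
exact/cvg_lim.
Qed.
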